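(* Let $(X,d_1)$ and $(Y,d_2)$ be metric spaces, and let $f:(X,d_1)\to(Y,d_2)$ be a homeomorphism. Suppose that there exists $L\ge 1$ such that for every $p\in X$ and all $x,y\in X\setminus\{p\}$, $$\frac{\tau_p(x,y)}{L}\le \tau_{f(p)}(f(x),f(y))\le L\,\tau_p(x,y).$$ Then $f$ is quasiconformal with linear dilatation $H(f)\le L^2$.
   Context: For a metric space $(Z,d)$ and $p\in Z$, the scale-invariant Cassinian metric on $Z\setminus\{p\}$ is $$\tau_p(x,y)=\log\left(1+2\frac{d(x,y)}{\sqrt{d(x,p)\,d(y,p)}}\right),\quad x,y\in Z\setminus\{p\}.$$ Here $\tau_p$ is taken in $(X,d_1)$ and $\tau_{f(p)}$ in $(Y,d_2)$. The linear dilatation of a homeomorphism $f$ at $z\in X$ is $$H(f,z)=\limsup_{r\to0^+}\ \sup\left\{\frac{d_2(f(x),f(z))}{d_2(f(y),f(z))}: x,y\in X,\ d_1(x,z)=d_1(y,z)=r\right\}$$ (radii $r$ for which there are no such points impose no condition), and $H(f)=\sup_{z\in X}H(f,z)$. The homeomorphism $f$ is quasiconformal if $H(f)<\infty$. *)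

(* Defs.v *)
From mathcomp Require Import all_boot all_order all_algebra.
From mathcomp Require Import all_classical all_reals all_analysis.

Set Implicit Arguments.
Unset Strict Implicit.
Unset Printing Implicit Defensive.

Import Order.TTheory GRing.Theory Num.Theory.
Import numFieldNormedType.Exports.

Local Open Scope classical_set_scope.
Local Open Scope ring_scope.

Definition homeomorphism (T U : topologicalType) (f : T -> U) : Prop :=
  continuous f /\
  exists g : U -> T, [/\ cancel f g, cancel g f & continuous g].

(* Total in x and y; meaningful only for x != p and y != p. *)
Definition cassinian_metric (R : realType) (Z : metricType R) (p x y : Z) : R :=
  ln (1 + 2 * (mdist x y / Num.sqrt (mdist x p * mdist y p))).

Section dilatation.
Context {R : realType} {X Y : metricType R}.
Implicit Types (f : X -> Y) (z : X) (r : R).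

Definition sphere_distortion f z r : \bar R :=
  ereal_sup [set (mdist (f xy.1) (f z) / mdist (f xy.2) (f z))%:E
            | xy in [set xy : X * X | mdist xy.1 z = r /\ mdist xy.2 z = r]].

(* A radius whose sphere is empty contributes [ereal_sup set0 = -oo], i.e.
   nothing; the dilatation is thus -oo at an isolated point z. *)
Definition linear_dilatation_at f z : \bar R :=
  limf_esup (sphere_distortion f z) 0^'+.

Definition linear_dilatation f : \bar R :=
  ereal_sup (range (linear_dilatation_at f)).

Definition quasiconformal f : Prop :=
  homeomorphism f /\ (linear_dilatation f < +oo)%E.

End dilatation.

(* Main.v *)
(* Fix a point p distinct from z. Since ln (1 + u) ~ u at 0, the Cassinian
   metric with base point p satisfies tau_p(x, z) ~ 2 d(x, z) / d(z, p) as x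
   tends to z, and likewise in Y with base point f(p). The bilipschitz bound
   therefore squeezes d(f x, f z) / d(x, z) asymptotically between c / L and
   L c with c = d(f z, f p) / d(z, p), and two points on a small sphere around
   z are distorted by a ratio at most L^2 (1 + o(1)). *)
Require Import Defs.
From mathcomp Require Import all_boot all_order all_algebra.
From mathcomp Require Import all_classical all_reals all_analysis.
From mathcomp Require Import ring.

Set Implicit Arguments.
Unset Strict Implicit.
Unset Printing Implicit Defensive.

Import Order.TTheory GRing.Theory Num.Theory.
Import numFieldNormedType.Exports.

Local Open Scope classical_set_scope.
Local Open Scope ring_scope.

(** This serves to compose with a limit over a punctured neighbourhood, such as that of
    [ln (1 + h) / h] at 0: the inner function must eventually avoid the limit point. *)
Lemma cvg_dnbhs_neq (S : Type) (T : topologicalType) (F : set_system S)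
    (FF : Filter F) (u : S -> T) (a : T) :
  u s @[s --> F] --> a -> (\forall s \near F, u s != a) ->
  u s @[s --> F] --> a^'.
Proof.
move=> ua una A /=; rewrite /dnbhs /within /= => Aa.
by apply: filterS2 (ua _ Aa) una => s /=; apply.
Qed.

(** Since [ln 1 = 0], this is the difference quotient of [ln] at 1, where the derivative is 1. *)
Lemma cvg_ln1D_div (R : realType) :
  ln (1 + h) / h @[h --> (0 : R)^'] --> (1 : R).
Proof.
have [] := @is_derive1_ln R 1 ltr01.
rewrite invr1 /derivable /derive => cv lim1.
rewrite -[X in _ --> X]lim1; apply: cvg_trans cv; apply: near_eq_cvg.
by near=> h; rewrite /= ln1 subr0 /GRing.scale /= mulr1 mulrC addrC.
Unshelve. all: by end_near. Qed.

Lemma cvg_mdistl (R : realType) (Z : metricType R) (p z : Z) :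
  mdist x p @[x --> z] --> mdist z p.
Proof.
apply/cvgrPdist_lt => e e0.
apply/metricType_numDomainType.nbhs_mdistP; exists e => //= x zx.
rewrite (le_lt_trans _ zx)// ler_norml lerBlDr lerBrDr.
rewrite [- _ + _]addrC lerBlDr !metric_triangle (metric_sym z x) addrC.
by rewrite metric_triangle.
Qed.

(** With [u x] the argument added to 1 inside the logarithm, the quotient factors as
    [(ln (1 + u x) / u x) * (2 / s x)]. Here [u x] tends to 0 without vanishing, and [s x] tends to
    [mdist z p]. *)
Lemma cvg_cassinian_metric_div (R : realType) (Z : metricType R) (p z : Z) :
  z != p ->
  cassinian_metric p x z / mdist x z @[x --> z^'] --> 2 / mdist z p.
Proof.
move=> zp; have D0 : 0 < mdist z p by rewrite mdist_gt0.
have cd (q : Z) : mdist x q @[x --> z^'] --> mdist z q.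
  by apply: cvg_within_filter; exact: cvg_mdistl.
pose s x := Num.sqrt (mdist x p * mdist z p).
have sD : Num.sqrt (mdist z p * mdist z p) = mdist z p.
  by rewrite -expr2 sqrtr_sqr ger0_norm// ltW.
have cs : s x @[x --> z^'] --> mdist z p.
  rewrite -[X in _ --> X]sD.
  apply: (cvg_comp (fun x => mdist x p * mdist z p) Num.sqrt); last first.
    exact: sqrt_continuous.
  exact: cvgM (cd p) (cvg_cst _).
have s0 : \forall x \near z^', 0 < s x by exact: cvgr_gt cs _ D0.
have csV : (s x)^-1 @[x --> z^'] --> (mdist z p)^-1.
  by apply: cvgV => //; rewrite gt_eqF.
pose u x := 2 * (mdist x z / s x).
have cu : u x @[x --> z^'] --> (0 : R)^'.
  apply: cvg_dnbhs_neq.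
    have : u x @[x --> z^'] --> 2 * (mdist z z / mdist z p).
      by apply: cvgM; [exact: cvg_cst | exact: cvgM].
    by rewrite mdistxx mul0r mulr0.
  near=> x; rewrite gt_eqF// mulr_gt0// divr_gt0//; last by near: x.
  by rewrite mdist_gt0; near: x; exact: nbhs_dnbhs_neq.
rewrite -[X in _ --> X]mul1r.
have : (ln (1 + u x) / u x) * (2 / s x) @[x --> z^'] --> 1 * (2 / mdist z p).
  apply: cvgM; last by apply: cvgM => //; exact: cvg_cst.
  exact: (cvg_comp u (fun h => ln (1 + h) / h) cu (@cvg_ln1D_div R)).
apply: cvg_trans; apply: near_eq_cvg; near=> x.
have sx : s x != 0 by rewrite gt_eqF//; near: x.
have dx : mdist x z != 0.
  by rewrite gt_eqF// mdist_gt0; near: x; exact: nbhs_dnbhs_neq.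
rewrite /cassinian_metric -/(s x) -/(u x) -mulrA; congr (_ * _).
by rewrite /u; field; rewrite sx dx.
Unshelve. all: by end_near. Qed.

(** The limit superior is an infimum of suprema over the members of [F], and the set where [g <= M]
    is itself such a member. *)
Lemma limf_esup_le (R : realType) (T : choiceType) (X : filteredType T)
    (F : set_system X) (g : X -> \bar R) (M : \bar R) :
  (\forall x \near F, (g x <= M)%E) -> (limf_esup g F <= M)%E.
Proof.
move=> FM; apply: ge_ereal_inf.
exists (ereal_sup (g @` [set x | (g x <= M)%E])).
  by exists [set x | (g x <= M)%E].
by apply: ge_ereal_sup => _ [x gM <-].
Qed.

(** For [x], [y] on a common sphere around [z] the radius cancels, which leaves a ratio of at most
    [L ^+ 2 * (q x / q y)]. Both values of [q] are close to [c > 0] on small spheres. *)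
Lemma linear_dilatation_at_le (R : realType) (X Y : metricType R) (f : X -> Y)
    (z : X) (L c : R) (q : X -> R) :
  0 < L -> 0 < c -> injective f -> q x @[x --> z^'] --> c ->
  (\forall x \near z^', q x / L * mdist x z <= mdist (f x) (f z)
     <= L * q x * mdist x z) ->
  (linear_dilatation_at f z <= (L ^+ 2)%:E)%E.
Proof.
move=> L0 c0 finj qc fq; apply/lee_addgt0Pr => e e0.
apply: limf_esup_le; rewrite -EFinD.
set M := L ^+ 2 + e.
have LM : L ^+ 2 < M by rewrite ltrDl.
have M0 : 0 < M by rewrite (lt_trans _ LM)// exprn_gt0.
(* The midpoint of [L ^+ 2] and [M], scaled by [c], separates the two sides: near [z],
   [L ^+ 2 * q x < m < M * q y]. *)
pose m := (L ^+ 2 + M) / 2 * c.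
have ltm : c < m / L ^+ 2.
  by rewrite ltr_pdivlMr ?exprn_gt0// [ltLHS]mulrC ltr_pM2r// midf_lt.
have gtm : m / M < c by rewrite ltr_pdivrMr// [ltRHS]mulrC ltr_pM2r// midf_lt.
have near_q : \forall x \near z^',
    [/\ q x / L * mdist x z <= mdist (f x) (f z) <= L * q x * mdist x z,
    q x < m / L ^+ 2 & m / M < q x].
  near=> x; split; near: x => //; first exact: cvgr_lt qc _ ltm.
  exact: cvgr_gt qc _ gtm.
(* A ball of radius [d] makes the bounds uniform: they hold at every point of each sphere of radius
   [r] with [0 < r < d]. *)
have [d /= d0 dq] := (metricType_numDomainType.nbhs_mdistP z _).1 near_q.
near=> r.
have r0 : 0 < r by near: r; exact: nbhs_right_gt.
apply: ge_ereal_sup => _ [[x y] /= [xr yr] <-]; rewrite lee_fin.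
have P w : mdist w z = r -> [/\ q w / L * r <= mdist (f w) (f z) <= L * q w * r,
    q w < m / L ^+ 2 & m / M < q w].
  move=> wr; rewrite -{1 2}wr; apply: dq; last by rewrite -mdist_gt0 wr.
  by rewrite /= metric_sym wr; near: r; exact: nbhs_right_lt.
have [/andP[_ fx] qx _] := P _ xr.
have [/andP[fy _] _ qy] := P _ yr.
have fy0 : 0 < mdist (f y) (f z).
  by rewrite mdist_gt0 (inj_eq finj) -mdist_gt0 yr.
rewrite ler_pdivrMr//.
move: qx qy; rewrite ltr_pdivlMr ?exprn_gt0// ltr_pdivrMr// => qx qy.
have qM : L * q x <= M * (q y / L).
  rewrite mulrA ler_pdivlMr// [M * _]mulrC (le_trans _ (ltW qy))//.
  by rewrite mulrAC -expr2 mulrC ltW.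
rewrite (le_trans fx)// (le_trans (ler_wpM2r (ltW r0) qM))//.
by rewrite -mulrA ler_wpM2l// ltW.
Unshelve. all: by end_near. Qed.

Theorem theorem5p4 (R : realType) (X Y : metricType R) (f : X -> Y)
  (f_homeo : homeomorphism f) (L : R) (L_ge1 : 1 <= L)
  (f_bilip : forall p x y : X, x != p -> y != p ->
     cassinian_metric p x y / L <= cassinian_metric (f p) (f x) (f y)
       <= L * cassinian_metric p x y) :
  quasiconformal f /\ (linear_dilatation f <= (L ^+ 2)%:E)%E.
Proof.
suff H : (linear_dilatation f <= (L ^+ 2)%:E)%E.
  by split=> //; split=> //; exact: le_lt_trans H (ltry _).
have [fc [g [/can_inj finj _ _]]] := f_homeo.
have L0 : 0 < L by exact: lt_le_trans L_ge1.
apply: ge_ereal_sup => _ [z _ <-].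
(* Without a second point to serve as base point, every sphere of positive radius is empty and its
   supremum is [-oo]. *)
have [[p pz]|nop] := pselect (exists p : X, p != z); last first.
  apply: limf_esup_le; near=> r; apply: ge_ereal_sup => _ [[x y] /= [xr _] <-].
  exfalso; apply: nop; exists x; rewrite -mdist_gt0 xr.
  by near: r; exact: nbhs_right_gt.
have zp : z != p by rewrite eq_sym.
have fzp : f z != f p by rewrite (inj_eq finj).
pose phi x := cassinian_metric p x z / mdist x z.
pose psi y := cassinian_metric (f p) y (f z) / mdist y (f z).
have phic : phi x @[x --> z^'] --> 2 / mdist z p.
  exact: cvg_cassinian_metric_div.
have psic : psi (f x) @[x --> z^'] --> 2 / mdist (f z) (f p).
  apply: (cvg_comp f psi); last exact: cvg_cassinian_metric_div.
  (* Injectivity keeps [f x] away from [f z], so the limit of [psi] over the punctured neighbourhood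
     of [f z] can be pulled back. *)
  apply: continuous_injective_withinNx; first exact: fc.
  by move=> x; exact: finj.
have phi0 : 0 < 2 / mdist z p by rewrite divr_gt0// mdist_gt0.
have psi0 : 0 < 2 / mdist (f z) (f p) by rewrite divr_gt0// mdist_gt0.
(* The hypothesis bounds [psi (f x) * mdist (f x) (f z)] by multiples of [phi x * mdist x z];
   dividing by [psi (f x)] gives [q = phi / psi]. *)
apply: (@linear_dilatation_at_le _ _ _ _ _ _ _ (fun x => phi x / psi (f x)) L0
  (divr_gt0 phi0 psi0) finj).
  by apply: cvgM => //; apply: cvgV => //; rewrite gt_eqF.
near=> x.
have xz : 0 < mdist x z.
  by rewrite mdist_gt0; near: x; exact: nbhs_dnbhs_neq.
have fxz : 0 < mdist (f x) (f z) by rewrite mdist_gt0 (inj_eq finj) -mdist_gt0.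
have xp : x != p.
  rewrite -mdist_gt0; near: x; apply: (cvgr_gt (mdist z p)).
    by apply: cvg_within_filter; exact: cvg_mdistl.
  by rewrite mdist_gt0.
have psix : 0 < psi (f x) by near: x; exact: cvgr_gt psic _ psi0.
have [] := andP (f_bilip p x z xp zp).
have -> : cassinian_metric p x z = phi x * mdist x z by rewrite divfK// gt_eqF.
have -> : cassinian_metric (f p) (f x) (f z) = psi (f x) * mdist (f x) (f z).
  by rewrite divfK// gt_eqF.
move=> lo up; apply/andP; split.
  have -> : phi x / psi (f x) / L * mdist x z
    = phi x * mdist x z / L / psi (f x) by ring.
  by rewrite ler_pdivrMr// [leRHS]mulrC.
have -> : L * (phi x / psi (f x)) * mdist x z
  = L * (phi x * mdist x z) / psi (f x) by ring.
by rewrite ler_pdivlMr// mulrC.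
Unshelve. all: by end_near. Qed.
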